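(* Let $\mathcal{D}\subseteq\mathbb{R}^n$ be a convex set and, for every $\omega\in\Omega$, let $f(x,\omega)=p(x,\omega)-q(x,\omega)$ be a dc decomposition of $f(\cdot,\omega)$ on $\mathcal{D}$, i.e. $p(\cdot,\omega)$ and $q(\cdot,\omega)$ are convex on $\mathcal{D}$. Then for every $\alpha\in(0,1)$ and $x\in\mathcal{D}$, $$\mathrm{CVaR}_\alpha(f(x,\tilde\omega))=\min_{t\in\mathbb{R}}\Big\{t+\frac{1}{1-\alpha}\,\mathbb{E}\max\big(p(x,\tilde\omega)-t,\ q(x,\tilde\omega)\big)\Big\}-\frac{1}{1-\alpha}\,\mathbb{E}\,q(x,\tilde\omega),$$ where both the function $x\mapsto\min_{t\in\mathbb{R}}\{t+\frac{1}{1-\alpha}\mathbb{E}\max(p(x,\tilde\omega)-t,q(x,\tilde\omega))\}$ and the function $x\mapsto\frac{1}{1-\alpha}\mathbb{E}\,q(x,\tilde\omega)$ are convex on $\mathcal{D}$.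
   Context: $\tilde\omega$ is a random variable on a probability space $(\Omega,\mathcal{F},\mathbb{P})$. It is assumed that $p(x,\cdot)$ and $q(x,\cdot)$ are measurable and integrable for each $x\in\mathcal{D}$. For a random variable $\mathcal{Z}$, $\mathrm{CVaR}_\alpha(\mathcal{Z})=\min_{t\in\mathbb{R}}\big[t+\frac{1}{1-\alpha}\mathbb{E}[\mathcal{Z}-t]_+\big]$, with $[\cdot]_+=\max(0,\cdot)$. *)

(* Defs.v *)
From HB Require Import structures.
From mathcomp Require Import all_boot all_order all_algebra.
From mathcomp Require Import all_classical all_reals all_analysis.

Set Implicit Arguments.
Unset Strict Implicit.
Unset Printing Implicit Defensive.

Import Order.TTheory GRing.Theory Num.Theory.
Import numFieldNormedType.Exports.

Local Open Scope classical_set_scope.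
Local Open Scope ring_scope.

Definition is_minimum (R : realType) (g : R -> R) (m : R) : Prop :=
  (exists t, g t = m) /\ (forall t, m <= g t).

Definition has_minimum (R : realType) (g : R -> R) : Prop :=
  exists m, is_minimum g m.

(* An arbitrary value (0) is returned when the minimum is not attained, so
   statements about [minimum g] should come with [has_minimum g]. *)
Definition minimum (R : realType) (g : R -> R) : R :=
  xget 0 [set m | is_minimum g m].

(* The library's expectation is extended-real-valued; [fine] returns its real
   value, which is meaningful whenever X is integrable. *)
Definition mean (d : measure_display) (T : measurableType d) (R : realType)
    (P : probability T R) (X : T -> R) : R :=
  fine ('E_P[X])%E.

Definition CVaR_objective (d : measure_display) (T : measurableType d)
    (R : realType) (P : probability T R) (alpha : R) (Z : T -> R) (t : R) : R :=
  t + (1 - alpha)^-1 * mean P (fun w => Num.max 0 (Z w - t)).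

Definition CVaR (d : measure_display) (T : measurableType d)
    (R : realType) (P : probability T R) (alpha : R) (Z : T -> R) : R :=
  minimum (CVaR_objective P alpha Z).

Definition dc_objective (d : measure_display) (T : measurableType d)
    (R : realType) (P : probability T R) (alpha : R) (U V : T -> R) (t : R) : R :=
  t + (1 - alpha)^-1 * mean P (fun w => Num.max (U w - t) (V w)).

Definition dc_decomposition (R : realType) (n : nat) (D : set 'rV[R]_n)
    (f p q : 'rV[R]_n -> R) : Prop :=
  [/\ convex_function D p, convex_function D q
    & forall x, D x -> f x = p x - q x].

(* Main.v *)
Require Import Defs.
From HB Require Import structures.
From mathcomp Require Import all_boot all_order all_algebra.
From mathcomp Require Import all_classical all_reals all_analysis.
From mathcomp Require Import lra.
Set Implicit Arguments.
Unset Strict Implicit.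
Unset Printing Implicit Defensive.

Import Order.TTheory GRing.Theory Num.Theory.
Import numFieldNormedType.Exports.
Local Open Scope classical_set_scope.
Local Open Scope ring_scope.

(** Since max(p - t, q) = q + max(0, f - t), the two objectives in t differ by
    the constant E q / (1 - alpha), which gives the formula.  The CVaR objective
    is Lipschitz in t and exceeds its value at 0 outside a bounded interval,
    because E max(0, Z - t) dominates both 0 and E Z - t while 1 / (1 - alpha) > 1;
    hence the minimum is attained.  The map (p, q, t) |-> t + E max(p - t, q) / (1 - alpha)
    is monotone and convex in (p, q, t), so evaluating it at the convex combination of
    the minimizers for x and y bounds the minimum at the corresponding point. *)

(** * Attained minima of real functions *)

Section minimum.
Context {R : realType}.
Implicit Types (g : R -> R) (m k t : R).

Lemma is_minimum_unique g m m' :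
  is_minimum g m -> is_minimum g m' -> m = m'.
Proof.
by move=> [[t <-] le_t] [[t' <-] le_t']; apply/le_anti; rewrite le_t le_t'.
Qed.

Lemma minimumE g m : is_minimum g m -> minimum g = m.
Proof.
(* The branch in which [xget] falls back on its default 0 is refuted by [gm]. *)
move=> gm; rewrite /minimum; case: xgetP => [m' _ gm'|/(_ m)//].
exact: is_minimum_unique gm' gm.
Qed.

Lemma minimumP g : has_minimum g -> is_minimum g (minimum g).
Proof. by move=> [m gm]; rewrite (minimumE gm). Qed.

Lemma is_minimum_shift g m k :
  is_minimum g m -> is_minimum (fun t => g t + k) (m + k).
Proof.
by move=> [[t gt] le_m]; split=> [|s]; [exists t; rewrite gt | rewrite lerD2r].
Qed.

Lemma lipschitz_continuous (g : R -> R) k : 0 < k ->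
  (forall s t, `|g s - g t| <= k * `|s - t|) -> continuous g.
Proof.
move=> k0 lip x; apply/cvgrPdist_lt => e e0.
near=> y; apply: le_lt_trans (lip _ _) _.
rewrite mulrC -ltr_pdivlMr//.
near: y; apply: cvgr_dist_lt; last exact: divr_gt0.
exact: cvg_id.
Unshelve. all: by end_near. Qed.

Lemma coercive_has_minimum g (a b : R) : continuous g ->
  (forall t, t < a -> g 0 <= g t) -> (forall t, b < t -> g 0 <= g t) ->
  has_minimum g.
Proof.
move=> cg ga gb.
(* Widening the interval to contain 0 makes it nonempty whatever the order of [a] and [b], and
   forces its minimum below [g 0], hence below all values outside. *)
have a0 : Num.min a 0 <= 0 by rewrite ge_min lexx orbT.
have b0 : 0 <= Num.max b 0 by rewrite le_max lexx orbT.
have [||c _ cmin] := @EVT_min R g (Num.min a 0) (Num.max b 0).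
- exact: le_trans b0.
- exact: continuous_subspaceT.
exists (g c); split=> [|t]; first by exists c.
have c0 : g c <= g 0 by apply: cmin; rewrite in_itv/= a0.
have [ta|ta] := ltP t (Num.min a 0).
  by apply: le_trans c0 (ga _ (lt_le_trans ta _)); rewrite ge_min lexx.
have [tb|tb] := ltP (Num.max b 0) t.
  by apply: le_trans c0 (gb _ (le_lt_trans _ tb)); rewrite le_max lexx.
by apply: cmin; rewrite in_itv/= ta.
Qed.

End minimum.

(** * Expectations and the two objectives in [t] *)

Section mean.
Context {d : measure_display} {T : measurableType d} {R : realType}.
Variable P : probability T R.
Implicit Types (X Y U V Z : T -> R) (r s t : R).

Local Notation intble X := (P.-integrable [set: T] (EFin \o X)).

Lemma meanE X : mean P X = \int[P]_w X w.
Proof. by rewrite /mean unlock. Qed.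

Lemma intble_cst r : intble (fun=> r).
Proof. exact: finite_measure_integrable_cst. Qed.

Lemma intbleD X Y : intble X -> intble Y -> intble (fun w => X w + Y w).
Proof. by move=> iX iY; exact: (integrableD measurableT iX iY). Qed.

Lemma intbleB X Y : intble X -> intble Y -> intble (fun w => X w - Y w).
Proof. by move=> iX iY; exact: (integrableB measurableT iX iY). Qed.

Lemma intbleZ r X : intble X -> intble (fun w => r * X w).
Proof. by move=> iX; exact: (integrableZl measurableT r iX). Qed.

(** Isolating a positive part serves twice: for the integrability of a maximum and for the
    comparison of the two objectives. *)
Lemma maxr_addr_pos (x y : R) : Num.max x y = Num.max 0 (x - y) + y.
Proof. by rewrite addr_maxl add0r subrK maxC. Qed.

Lemma intble_max X Y : intble X -> intble Y ->
  intble (fun w => Num.max (X w) (Y w)).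
Proof.
move=> iX iY; under eq_fun do rewrite maxr_addr_pos maxC.
by apply: intbleD => //; apply: integrable_funrpos => //; apply: intbleB.
Qed.

Lemma mean_cst r : mean P (fun=> r) = r.
Proof. by rewrite meanE Rintegral_cst// (congr1 fine (@probability_setT _ _ _ P)) mulr1. Qed.

Lemma meanD X Y : intble X -> intble Y ->
  mean P (fun w => X w + Y w) = mean P X + mean P Y.
Proof. by move=> iX iY; rewrite !meanE RintegralD. Qed.

Lemma meanZ r X : intble X -> mean P (fun w => r * X w) = r * mean P X.
Proof. by move=> iX; rewrite !meanE RintegralZl. Qed.

Lemma mean_le X Y : intble X -> intble Y -> (forall w, X w <= Y w) ->
  mean P X <= mean P Y.
Proof. by move=> iX iY XY; rewrite !meanE le_Rintegral. Qed.

Lemma intble_excess U V t : intble U -> intble V ->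
  intble (fun w => Num.max (U w - t) (V w)).
Proof. by move=> iU iV; apply: intble_max => //; apply/intbleB/intble_cst. Qed.

Lemma intble_pos Z t : intble Z -> intble (fun w => Num.max 0 (Z w - t)).
Proof.
by move=> iZ; apply/intble_max/intbleB/intble_cst => //; exact: intble_cst.
Qed.

Lemma CVaR_objective_has_minimum alpha Z : 0 < alpha < 1 -> intble Z ->
  has_minimum (CVaR_objective P alpha Z).
Proof.
move=> /andP[alpha0 alpha1] iZ.
rewrite /CVaR_objective; set c := (1 - alpha)^-1; set g := (X in has_minimum X).
have c1 : 1 < c by rewrite invf_gt1; lra.
have c0 : 0 < c by lra.
(* Dropping the nonnegative expectation gives the bound used for large [t]. *)
have gt t : t <= g t.
  rewrite lerDl mulr_ge0 ?(ltW c0)// -[leLHS]mean_cst.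
  apply: mean_le => [||w]; [exact: intble_cst | exact: intble_pos |].
  by rewrite le_max lexx.
(* The bound used for very negative [t]: its slope [-(c - 1)] is negative because [1 < c]. Reading
   [t] as the mean of a constant reduces it to a pointwise inequality. *)
have gZ t : c * mean P Z - (c - 1) * t <= g t.
  have : mean P Z <= t + mean P (fun w => Num.max 0 (Z w - t)).
    rewrite -{1}(mean_cst t) -meanD; [|exact: intble_cst|exact: intble_pos].
    apply: mean_le => // [|w].
      by apply: intbleD; [exact: intble_cst|exact: intble_pos].
    by rewrite -lerBlDl le_max lexx orbT.
  by rewrite /g => /(ler_wpM2l (ltW c0)); rewrite mulrDr; lra.
(* In the constant, 1 comes from the summand [t] and [c] from the positive part, which is
   1-Lipschitz in [t]. Exchanging [s] and [t] gives the absolute value. *)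
have lip1 s t : g s - g t <= (1 + c) * `|s - t|.
  have : mean P (fun w => Num.max 0 (Z w - s))
      <= `|s - t| + mean P (fun w => Num.max 0 (Z w - t)).
    rewrite -{1}(mean_cst `|s - t|) -meanD; [|exact: intble_cst|exact: intble_pos].
    apply: mean_le => [||w]; [exact: intble_pos| |].
      by apply: intbleD; [exact: intble_cst|exact: intble_pos].
    have st : t - s <= `|s - t| by rewrite distrC ler_norm.
    rewrite ge_max; apply/andP; split.
      by rewrite addr_ge0// le_max lexx.
    have : Z w - t <= Num.max 0 (Z w - t) by rewrite le_max lexx orbT.
    by lra.
  move=> /(ler_wpM2l (ltW c0)); rewrite mulrDr.
  by have := ler_norm (s - t); rewrite /g; lra.
(* The endpoints are the points where the lower bounds [gZ] and [gt] reach the value [g 0]. *)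
apply: (@coercive_has_minimum _ _ ((c * mean P Z - g 0) / (c - 1)) (g 0)).
- apply: (@lipschitz_continuous _ _ (1 + c)) => [|s t]; first by lra.
  by rewrite ler_norml lip1 lerNl opprB distrC lip1.
- move=> t; rewrite ltr_pdivlMr ?subr_gt0// => tlt.
  by apply: le_trans (gZ t); lra.
- by move=> t lt; apply: le_trans (ltW lt) (gt t).
Qed.

Lemma dc_objectiveE alpha U V t : intble U -> intble V ->
  dc_objective P alpha U V t =
  CVaR_objective P alpha (fun w => U w - V w) t + (1 - alpha)^-1 * mean P V.
Proof.
move=> iU iV; rewrite /dc_objective /CVaR_objective -addrA -mulrDr -meanD//.
  congr (_ + _ * mean P _); apply/funext => w.
  by rewrite maxr_addr_pos addrAC.
by apply: intble_pos; exact: intbleB.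
Qed.

Lemma dc_objective_has_minimum alpha U V : 0 < alpha < 1 ->
  intble U -> intble V -> has_minimum (dc_objective P alpha U V).
Proof.
move=> alpha01 iU iV.
have [m /is_minimum_shift hm] :=
  CVaR_objective_has_minimum alpha01 (intbleB iU iV).
exists (m + (1 - alpha)^-1 * mean P V).
by under [dc_objective _ _ _ _]funext do rewrite dc_objectiveE//.
Qed.

Lemma CVaR_dc alpha U V : 0 < alpha < 1 -> intble U -> intble V ->
  CVaR P alpha (fun w => U w - V w) =
  minimum (dc_objective P alpha U V) - (1 - alpha)^-1 * mean P V.
Proof.
move=> alpha01 iU iV.
have /minimumP/is_minimum_shift hm :=
  CVaR_objective_has_minimum alpha01 (intbleB iU iV).
under [dc_objective _ _ _ _]funext do rewrite dc_objectiveE//.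
by rewrite (minimumE (hm _)) addrK.
Qed.

(** With nonnegative weights, the right-hand side dominates each argument of the left-hand
    maximum. *)
Lemma maxr_convex (r x y x' y' : R) : 0 <= r <= 1 ->
  Num.max (r * x + (1 - r) * x') (r * y + (1 - r) * y') <=
  r * Num.max x y + (1 - r) * Num.max x' y'.
Proof.
move=> /andP[r0 r1]; have r1' : 0 <= 1 - r by rewrite subr_ge0.
by rewrite ge_max !lerD// ler_wpM2l// le_max lexx ?orbT.
Qed.

Lemma mean_convex r X X' Y : 0 <= r <= 1 ->
  intble X -> intble X' -> intble Y ->
  (forall w, Y w <= r * X w + (1 - r) * X' w) ->
  mean P Y <= r * mean P X + (1 - r) * mean P X'.
Proof.
move=> r01 iX iX' iY le_w; rewrite -!meanZ// -meanD; [|exact: intbleZ..].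
by apply: mean_le => //; apply: intbleD; exact: intbleZ.
Qed.

(** [U''] and [V''] are merely bounded by the combinations, as convexity of [p] and [q] provides;
    the objective is monotone in both. Since [t] enters affinely, distinct [t] and [t'] may be
    mixed. *)
Lemma dc_objective_convex alpha r t t' U V U' V' U'' V'' :
  0 < alpha < 1 -> 0 <= r <= 1 ->
  intble U -> intble V -> intble U' -> intble V' -> intble U'' -> intble V'' ->
  (forall w, U'' w <= r * U w + (1 - r) * U' w) ->
  (forall w, V'' w <= r * V w + (1 - r) * V' w) ->
  dc_objective P alpha U'' V'' (r * t + (1 - r) * t') <=
  r * dc_objective P alpha U V t + (1 - r) * dc_objective P alpha U' V' t'.
Proof.
move=> /andP[_ alpha1] r01 iU iV iU' iV' iU'' iV'' leU leV.
have c0 : 0 <= (1 - alpha)^-1 by rewrite invr_ge0 subr_ge0 ltW.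
suff /(ler_wpM2l c0) :
    mean P (fun w => Num.max (U'' w - (r * t + (1 - r) * t')) (V'' w)) <=
    r * mean P (fun w => Num.max (U w - t) (V w)) +
    (1 - r) * mean P (fun w => Num.max (U' w - t') (V' w)).
  by rewrite /dc_objective; lra.
apply: mean_convex => // [| | |w]; [exact: intble_excess..|].
apply: le_trans (maxr_convex _ _ _ _ r01); apply: le_max2 => //.
by have := leU w; lra.
Qed.

End mean.

Theorem proposition1 (R : realType)
  (d : measure_display) (T : measurableType d) (P : probability T R)
  (d' : measure_display) (E : measurableType d') (omega : {RV P >-> E})
  (n : nat) (D : set 'rV[R]_n) (f p q : 'rV[R]_n -> E -> R)
  (hD : convex_set D)
  (hmeas : forall x, D x ->
    measurable_fun [set: E] (p x) /\ measurable_fun [set: E] (q x))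
  (hint : forall x, D x ->
    P.-integrable [set: T] (fun w => (p x (omega w))%:E) /\
    P.-integrable [set: T] (fun w => (q x (omega w))%:E))
  (hdc : forall e : E,
    dc_decomposition D (fun x => f x e) (fun x => p x e) (fun x => q x e))
  (alpha : R) (halpha : 0 < alpha < 1) :
  (forall x, D x ->
    [/\ has_minimum (CVaR_objective P alpha (fun w => f x (omega w))),
        has_minimum (dc_objective P alpha (fun w => p x (omega w))
                                          (fun w => q x (omega w)))
      & CVaR P alpha (fun w => f x (omega w)) =
          minimum (dc_objective P alpha (fun w => p x (omega w))
                                        (fun w => q x (omega w)))
          - (1 - alpha)^-1 * mean P (fun w => q x (omega w))]) /\
  convex_function D
    (fun x => minimum (dc_objective P alpha (fun w => p x (omega w))
                                            (fun w => q x (omega w)))) /\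
  convex_function D
    (fun x => (1 - alpha)^-1 * mean P (fun w => q x (omega w))).
Proof.
have intp x : D x -> P.-integrable [set: T] (EFin \o (fun w => p x (omega w))).
  by move=> /hint[].
have intq x : D x -> P.-integrable [set: T] (EFin \o (fun w => q x (omega w))).
  by move=> /hint[].
have f_dc x : D x ->
    (fun w => f x (omega w)) = (fun w => p x (omega w) - q x (omega w)).
  by move=> Dx; apply/funext => w; have [_ _ ->] := hdc (omega w).
have r01 (r : {i01 R}) : 0 <= r%:num <= 1 by rewrite ge0 le1.
split; last split.
- move=> x Dx; rewrite f_dc//; split; last exact: CVaR_dc (intp x Dx) (intq x Dx).
    apply: CVaR_objective_has_minimum => //.
    by apply: intbleB; [exact: intp|exact: intq].
  by apply: dc_objective_has_minimum; [|exact: intp|exact: intq].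
- move=> r x y xD yD.
  have Dz := set_mem (hD x y r xD yD).
  have [Dx Dy] := (set_mem xD, set_mem yD).
  have mP z (Dz' : D z) :=
    minimumP (dc_objective_has_minimum halpha (intp z Dz') (intq z Dz')).
  (* The minima at [x] and [y] become values at minimizers [t] and [t']; the minimum at the combined
     point is at most the value at their combination. *)
  have [[t <-] _] := mP x Dx; have [[t' <-] _] := mP y Dy.
  have [_ /(_ (r%:num * t + (1 - r%:num) * t'))/le_trans] := mP _ Dz; apply.
  apply: dc_objective_convex => //; [exact: intp|exact: intq|exact: intp|
    exact: intq|exact: intp|exact: intq| |] => w;
    have [cp cq _] := hdc (omega w); [exact: cp|exact: cq].
- move=> r x y xD yD.
  have Dz := set_mem (hD x y r xD yD).
  have [Dx Dy] := (set_mem xD, set_mem yD).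
  have c0 : 0 <= (1 - alpha)^-1.
    by case/andP: halpha => _ ?; rewrite invr_ge0 subr_ge0 ltW.
  suff /(ler_wpM2l c0)/le_trans : mean P (fun w => q (conv r x y) (omega w)) <=
      r%:num * mean P (fun w => q x (omega w)) +
      (1 - r%:num) * mean P (fun w => q y (omega w)).
    (* The bound sought is a [conv] of reals, unfolded here into the weights [r] and [1 - r]. *)
    by apply; rewrite convRE /unstable.onem; lra.
  apply: mean_convex => //; [exact: intq..|] => w.
  by have [_ cq _] := hdc (omega w); exact: cq.
Qed.
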